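(* Let $\mathbb{K}$ be a field of characteristic zero, $G$ a finite group, and $(L,[\cdot,\cdot],\alpha)$ a multiplicative Hom-Leibniz algebra over $\mathbb{K}$ equipped with an action of $G$. Let $(m_t,\alpha_t)$, $m_t=\sum_{i\ge0}m_it^i$, $\alpha_t=\sum_{i\ge0}\alpha_it^i$, be an equivariant one-parameter formal deformation of $(G,L,[\cdot,\cdot],\alpha)$. Then its equivariant infinitesimal $(m_1,\alpha_1)$ is a $2$-cocycle of the equivariant Hom-Leibniz cohomology, i.e. $(m_1,\alpha_1)\in\widetilde{CL}^2_G(L,L)$ and $\partial(m_1,\alpha_1)=0$.
   Context: A Hom-Leibniz algebra over $\mathbb{K}$ is a $\mathbb{K}$-vector space $L$ with a $\mathbb{K}$-bilinear map $[\cdot,\cdot]:L\times L\to L$ and a $\mathbb{K}$-linear map $\alpha:L\to L$ such that $[\alpha(x),[y,z]]=[[x,y],\alpha(z)]-[[x,z],\alpha(y)]$ for all $x,y,z\in L$. It is multiplicative if $\alpha([x,y])=[\alpha(x),\alpha(y)]$. An action of $G$ on it is a left action of $G$ on $L$ by $\mathbb{K}$-linear maps such that $g[x,y]=[gx,gy]$ and $\alpha(gx)=g\alpha(x)$ for all $g\in G$, $x,y\in L$. An equivariant one-parameter formal deformation of $(G,L,[\cdot,\cdot],\alpha)$ is a pair of a $\mathbb{K}[[t]]$-bilinear map $m_t=\sum_{i\ge0}m_it^i:L[[t]]\times L[[t]]\to L[[t]]$ and a $\mathbb{K}[[t]]$-linear map $\alpha_t=\sum_{i\ge0}\alpha_it^i:L[[t]]\to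 L[[t]]$, where the $m_i:L\times L\to L$ are $\mathbb{K}$-bilinear, the $\alpha_i:L\to L$ are $\mathbb{K}$-linear, $m_0=[\cdot,\cdot]$, $\alpha_0=\alpha$, $m_i(gx,gy)=gm_i(x,y)$ and $\alpha_i(gx)=g\alpha_i(x)$ for all $g\in G$, $i\ge0$, and $m_t(\alpha_t(x),m_t(y,z))=m_t(m_t(x,y),\alpha_t(z))-m_t(m_t(x,z),\alpha_t(y))$, $m_t(\alpha_t(x),\alpha_t(y))=\alpha_t(m_t(x,y))$. Its equivariant infinitesimal is $(m_1,\alpha_1)$. $\widetilde{CL}^2(L,L)=\mathrm{Hom}_{\mathbb{K}}(L^{\otimes2},L)\oplus\mathrm{Hom}_{\mathbb{K}}(L,L)$, $\widetilde{CL}^3(L,L)=\mathrm{Hom}_{\mathbb{K}}(L^{\otimes3},L)\oplus\mathrm{Hom}_{\mathbb{K}}(L^{\otimes2},L)$; $\widetilde{CL}^n_G(L,L)\subseteq\widetilde{CL}^n(L,L)$ is the subspace of pairs whose two components are both $G$-equivariant (commute with the diagonal $G$-action on arguments). For $(\phi,\psi)\in\widetilde{CL}^2(L,L)$, $\partial(\phi,\psi)=(\partial_{\gamma\gamma}\phi-\partial_{\alpha\gamma}\psi,\ \partial_{\gamma\alpha}\phi-\partial_{\alpha\alpha}\psi)$ with $(\partial_{\gamma\gamma}\phi)(x,y,z)=[\alpha(x),\phi(y,z)]+[\phi(x,z),\alpha(y)]-[\phi(x,y),\alpha(z)]-\phi([x,y],\alpha(z))+\phi([x,z],\alpha(y))+\phi(\alpha(x),[y,z])$,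 $(\partial_{\alpha\gamma}\psi)(x,y,z)=[[x,y],\psi(z)]-[[x,z],\psi(y)]-[\psi(x),[y,z]]$, $(\partial_{\gamma\alpha}\phi)(x,y)=\alpha(\phi(x,y))-\phi(\alpha(x),\alpha(y))$, $(\partial_{\alpha\alpha}\psi)(x,y)=[\alpha(x),\psi(y)]+[\psi(x),\alpha(y)]-\psi([x,y])$. *)

(* Defs.v *)
(* mathcomp.classical makes function types zmodTypes with pointwise operations. *)
From HB Require Import structures.
From mathcomp Require Import all_boot all_order all_fingroup all_algebra.
From mathcomp Require Import all_classical.
Set Implicit Arguments.
Unset Strict Implicit.
Unset Printing Implicit Defensive.
Import GRing.Theory.
Local Open Scope ring_scope.
Local Open Scope classical_set_scope.

(* [fps V] is V[[t]]: the series \sum_n (f n) t^n is the function f.  The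
   addition is pointwise; fps K is the commutative ring K[[t]] under the Cauchy
   product, and fps L is the K[[t]]-module L[[t]]. *)
Definition fps (V : Type) : Type := nat -> V.

HB.instance Definition _ (V : zmodType) := GRing.Zmodule.copy (fps V) (nat -> V).

Definition fps_const (V : zmodType) (x : V) : fps V :=
  fun n => if n == 0%N then x else 0.

Definition fps_scale (K : comNzRingType) (L : lmodType K)
    (f : fps K) (x : fps L) : fps L :=
  fun n => \sum_(i < n.+1) f i *: x (n - i)%N.

Definition fps_mul (K : comNzRingType) (f g : fps K) : fps K :=
  fun n => \sum_(i < n.+1) f i * g (n - i)%N.

Section FpsScale.
Variables (K : comNzRingType) (L : lmodType K).
Implicit Types (f g : fps K) (x y : fps L).

Lemma fps_scaleA f g x :
  fps_scale f (fps_scale g x) = fps_scale (fps_mul f g) x.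
Proof.
apply/funext => n; rewrite /fps_scale /fps_mul.
pose F i j := (f i * g j) *: x (n - i - j)%N.
transitivity (\sum_(i < n.+1) \sum_(j < n.+1 | (j <= n - i)%N) F i j).
  apply: eq_bigr => i _; rewrite scaler_sumr.
  rewrite (big_ord_widen_cond n.+1 xpredT
    (fun j => f i *: (g j *: x (n - i - j)%N))) ?ltnS ?leq_subr //.
  by apply: eq_bigr => j _; rewrite scalerA.
rewrite [RHS](eq_bigr (fun k : 'I_n.+1 =>
  \sum_(i < n.+1 | (i <= k)%N) (f i * g (k - i)%N) *: x (n - k)%N)); last first.
  move=> k _; rewrite scaler_suml (big_ord_widen_cond n.+1 xpredT
    (fun i => (f i * g (k - i)%N) *: x (n - k)%N)) //.
rewrite [RHS](exchange_big_dep xpredT) //=; apply: eq_bigr => i _.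
have le_in : (i <= n)%N by rewrite -ltnS.
rewrite -(big_mkord (fun j => (j <= n - i)%N) (F i)).
rewrite -(big_mkord (fun k => (i <= k)%N)
  (fun k => (f i * g (k - i)%N) *: x (n - k)%N)).
rewrite [RHS](big_cat_nat (n := i)) //= ?(leqW le_in) //.
rewrite [X in _ = X + _]big_nat_cond [X in _ = X + _]big1 ?add0r; last first.
  by move=> k /andP[/andP[_ ki] ik]; rewrite leqNgt ki in ik.
rewrite -[X in _ = \sum_(X <= _ < _ | _) _]add0n big_addn subSn //.
rewrite (big_cat_nat (n := (n - i).+1)) //= ?ltnS ?leq_subr //.
rewrite [X in _ + X = _]big_nat_cond [X in _ + X = _]big1 ?addr0; last first.
  by move=> k /andP[/andP[ik _] ki]; rewrite leqNgt ik in ki.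
rewrite big_nat_cond [RHS]big_nat_cond; apply: eq_big => [j|j _].
  by rewrite leq_addl andbT ltnS leq0n andbb.
by rewrite /F addnK subnDA [(n - i - j)%N]subnAC.
Qed.

Lemma fps_scale1 : left_id (fps_const 1 : fps K) (@fps_scale K L).
Proof.
move=> x; apply/funext => n; rewrite /fps_scale big_ord_recl subn0 scale1r.
by rewrite big1 ?addr0 // => i _; rewrite scale0r.
Qed.

Lemma fps_scaleDr : right_distributive (@fps_scale K L) +%R.
Proof.
move=> f x y; apply/funext => n; rewrite /fps_scale.
by rewrite [RHS]/GRing.add/= -big_split; apply: eq_bigr => i _; exact: scalerDr.
Qed.

Lemma fps_scaleDl x : {morph (@fps_scale K L)^~ x : f g / f + g}.
Proof.
move=> f g; apply/funext => n; rewrite /fps_scale.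
by rewrite [RHS]/GRing.add/= -big_split; apply: eq_bigr => i _; exact: scalerDl.
Qed.

End FpsScale.

Section FpsRing.
Variable K : comNzRingType.

Lemma fps_mulA : associative (@fps_mul K).
Proof. exact: (@fps_scaleA K K^o). Qed.

Lemma fps_mulC : commutative (@fps_mul K).
Proof.
move=> f g; apply/funext => n; rewrite /fps_mul (reindex_inj rev_ord_inj) /=.
apply: eq_bigr => i _; rewrite subSS subKn; first exact: mulrC.
by rewrite -ltnS.
Qed.

Lemma fps_mul1 : left_id (fps_const 1) (@fps_mul K).
Proof. exact: (@fps_scale1 K K^o). Qed.

Lemma fps_mulDl : left_distributive (@fps_mul K) +%R.
Proof. move=> f g h; exact: (@fps_scaleDl K K^o). Qed.

Lemma fps_oner_neq0 : (fps_const 1 : fps K) != 0.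
Proof.
by apply/eqP => /(congr1 (fun f : fps K => f 0%N))/eqP; rewrite oner_eq0.
Qed.

HB.instance Definition _ := GRing.Zmodule_isComNzRing.Build (fps K)
  fps_mulA fps_mulC fps_mul1 fps_mulDl fps_oner_neq0.

End FpsRing.

HB.instance Definition _ (K : comNzRingType) (L : lmodType K) :=
  GRing.Zmodule_isLmodule.Build (fps K) (fps L)
    (@fps_scaleA K L) (@fps_scale1 K L) (@fps_scaleDr K L) (@fps_scaleDl K L).

Section HomLeibniz.
Variables (K : fieldType) (L : lmodType K).

Record homLeibniz := HomLeibniz {
  bracket : {bilinear L -> L -> L};
  twist : {linear L -> L};
  hom_leibnizP : forall x y z,
    bracket (twist x) (bracket y z) =
    bracket (bracket x y) (twist z) - bracket (bracket x z) (twist y)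
}.

Definition multiplicative (A : homLeibniz) : Prop :=
  forall x y, twist A (bracket A x y) = bracket A (twist A x) (twist A y).

Record homLeibniz_action (G : finGroupType) (A : homLeibniz) :=
  HomLeibnizAction {
    act : G -> {linear L -> L};
    act1 : forall x, act 1%g x = x;
    actM : forall g h x, act (g * h)%g x = act g (act h x);
    act_bracket : forall g x y,
      act g (bracket A x y) = bracket A (act g x) (act g y);
    act_twist : forall g x, twist A (act g x) = act g (twist A x)
  }.

Section Deformation.
Variables (G : finGroupType) (A : homLeibniz) (rho : homLeibniz_action G A).

(* A K[[t]]-(bi)linear map is determined by its values on L, so the two
   expansion fields say m_t = \sum_i m_i t^i and alpha_t = \sum_i alpha_i t^i. *)
Record equivariant_deformation := EquivariantDeformation {
  defm_t : {bilinear fps L -> fps L -> fps L};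
  defa_t : {linear fps L -> fps L};
  defm : nat -> {bilinear L -> L -> L};
  defa : nat -> {linear L -> L};
  defm_tE : forall x y i, defm_t (fps_const x) (fps_const y) i = defm i x y;
  defa_tE : forall x i, defa_t (fps_const x) i = defa i x;
  defm0 : forall x y, defm 0 x y = bracket A x y;
  defa0 : forall x, defa 0 x = twist A x;
  defm_equiv : forall g i x y,
    defm i (act rho g x) (act rho g y) = act rho g (defm i x y);
  defa_equiv : forall g i x, defa i (act rho g x) = act rho g (defa i x);
  def_hom_leibniz : forall x y z : fps L,
    defm_t (defa_t x) (defm_t y z) =
    defm_t (defm_t x y) (defa_t z) - defm_t (defm_t x z) (defa_t y);
  def_multiplicative : forall x y : fps L,
    defm_t (defa_t x) (defa_t y) = defa_t (defm_t x y)
}.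

(* Hom(L (x) L, L) is rendered as the bilinear maps L -> L -> L. *)
Definition cochain2 : Type := (L -> L -> L) * (L -> L).

Definition CL2 : set cochain2 := [set c |
  [/\ forall x, linear (c.1 x), forall y, linear (c.1^~ y) & linear c.2]].

Definition CL2G : set cochain2 := CL2 `&` [set c |
  (forall g x y, c.1 (act rho g x) (act rho g y) = act rho g (c.1 x y)) /\
  (forall g x, c.2 (act rho g x) = act rho g (c.2 x))].

Definition infinitesimal (D : equivariant_deformation) : cochain2 :=
  (defm D 1 : L -> L -> L, defa D 1 : L -> L).

End Deformation.

Section Coboundary.
Variable A : homLeibniz.
Local Notation "[ x , y ]" := (bracket A x y).
Local Notation alpha := (twist A).

Definition d_gamma_gamma (phi : L -> L -> L) : L -> L -> L -> L :=
  fun x y z =>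
    [alpha x, phi y z] + [phi x z, alpha y] - [phi x y, alpha z]
    - phi [x, y] (alpha z) + phi [x, z] (alpha y) + phi (alpha x) [y, z].

Definition d_alpha_gamma (psi : L -> L) : L -> L -> L -> L :=
  fun x y z => [[x, y], psi z] - [[x, z], psi y] - [psi x, [y, z]].

Definition d_gamma_alpha (phi : L -> L -> L) : L -> L -> L :=
  fun x y => alpha (phi x y) - phi (alpha x) (alpha y).

Definition d_alpha_alpha (psi : L -> L) : L -> L -> L :=
  fun x y => [alpha x, psi y] + [psi x, alpha y] - psi [x, y].

(* The codomain is the space of all pairs of maps; it contains CL^3(L, L) as
   the subspace of (trilinear, bilinear) pairs, with the same zero. *)
Definition coboundary (c : cochain2) : (L -> L -> L -> L) * (L -> L -> L) :=
  (d_gamma_gamma c.1 - d_alpha_gamma c.2,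
   d_gamma_alpha c.1 - d_alpha_alpha c.2).

End Coboundary.

End HomLeibniz.

(* Main.v *)
Require Import Defs.
From mathcomp Require Import all_boot all_order all_fingroup all_algebra.
From mathcomp Require Import all_classical.
Local Open Scope ring_scope.

(** Write u = u_0 + t u' for u in L[[t]].  By K[[t]]-bilinearity, the
    coefficient of t in m_t(u, v) is [u_0, v_1] + [u_1, v_0] + m_1(u_0, v_0),
    and that in alpha_t(u) is alpha(u_1) + alpha_1(u_0).  The two components of
    the cocycle equation are the coefficients of t in the Hom-Leibniz and
    multiplicativity identities evaluated at constant series. *)

Definition fps_var (K : comNzRingType) : fps K := fun n => (n == 1%N)%:R.

Definition fps_shift {V : Type} (x : fps V) : fps V := fun n => x n.+1.

Lemma coef_fpsD (V : zmodType) (x y : fps V) n : (x + y) n = x n + y n.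
Proof. by []. Qed.

Lemma coef_fpsB (V : zmodType) (x y : fps V) n : (x - y) n = x n - y n.
Proof. by []. Qed.

Section FpsShift.
Import GRing.
Variables (K : comNzRingType) (L : lmodType K).
Implicit Types x : fps L.

Lemma coef0_fps_varZ x : (fps_var K *: x) 0%N = 0.
Proof. by rewrite [LHS]big_ord_recl big_ord0 scale0r addr0. Qed.

Lemma coefS_fps_varZ x n : (fps_var K *: x) n.+1 = x n.
Proof.
rewrite [LHS]big_ord_recl big_ord_recl /= scale0r add0r scale1r subSS subn0.
by rewrite big1 ?addr0 // => i _; rewrite scale0r.
Qed.

Lemma fps_shiftE x : x = fps_const (x 0%N) + fps_var K *: fps_shift x.
Proof.
apply/funext => -[|n]; rewrite coef_fpsD.
  by rewrite coef0_fps_varZ addr0.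
by rewrite coefS_fps_varZ add0r.
Qed.

End FpsShift.

Section Coefficients.
Import GRing.
Context {K : fieldType} {L : lmodType K} {A : homLeibniz L} {G : finGroupType}.
Context {rho : homLeibniz_action G A} (D : equivariant_deformation rho).
Implicit Types u v : fps L.

Lemma coef0_defa_t u : defa_t D u 0%N = twist A (u 0%N).
Proof.
rewrite {1}[u]fps_shiftE linearD linearZ_LR coef_fpsD.
by rewrite coef0_fps_varZ addr0 defa_tE defa0.
Qed.

(** The factor t lowers the degree by one, so the remainder contributes the constant term of alpha_t
    at [fps_shift u], already known from [coef0_defa_t]. *)
Lemma coef1_defa_t u :
  defa_t D u 1%N = defa D 1 (u 0%N) + twist A (u 1%N).
Proof.
rewrite {1}[u]fps_shiftE linearD linearZ_LR coef_fpsD.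
by rewrite coefS_fps_varZ coef0_defa_t defa_tE.
Qed.

(** The splitting is asymmetric: [v] stays whole beside [fps_shift u], because up to degree 1 only
    the constant term of that product matters. *)
Lemma defm_t_shiftE u v :
  defm_t D u v = defm_t D (fps_const (u 0%N)) (fps_const (v 0%N))
    + fps_var K *: (defm_t D (fps_const (u 0%N)) (fps_shift v)
                    + defm_t D (fps_shift u) v).
Proof.
rewrite {1}[u]fps_shiftE linearDl linearZl_LR {1}[v]fps_shiftE.
by rewrite linearDr linearZr_LR scalerDr addrA.
Qed.

Lemma coef0_defm_t u v : defm_t D u v 0%N = bracket A (u 0%N) (v 0%N).
Proof.
rewrite defm_t_shiftE coef_fpsD.
by rewrite coef0_fps_varZ addr0 defm_tE defm0.
Qed.

Lemma coef1_defm_t u v :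
  defm_t D u v 1%N = defm D 1 (u 0%N) (v 0%N)
    + (bracket A (u 0%N) (v 1%N) + bracket A (u 1%N) (v 0%N)).
Proof.
rewrite defm_t_shiftE coef_fpsD defm_tE.
by rewrite coefS_fps_varZ coef_fpsD !coef0_defm_t.
Qed.

Lemma infinitesimal_hom_leibniz x y z :
  d_gamma_gamma A (defm D 1) x y z = d_alpha_gamma A (defa D 1) x y z.
Proof.
have /(congr1 (fun u : fps L => u 1%N)) :=
  def_hom_leibniz D (fps_const x) (fps_const y) (fps_const z).
(* The explicit second arguments select the outer products; the inner ones have constant entries, so
   [defm_tE] reads off their coefficients. *)
rewrite coef_fpsB !(coef1_defm_t _ (defa_t D _)).
rewrite !(coef1_defm_t _ (defm_t D _ _)) !coef0_defm_t !coef0_defa_t.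
rewrite !defa_tE !defm_tE.
(* The 0 of the goal is replaced by the sum that [H] equates with 0, which leaves two sums of the
   same nine terms. *)
move=> /eqP; rewrite -subr_eq0 => /eqP H; apply/eqP; rewrite -subr_eq0 -H.
rewrite /d_gamma_gamma /d_alpha_gamma !opprD !opprK !addrA.
(* The permutation groups the terms by the three outer products of the identity, three terms for
   each. *)
by rewrite [eqbLHS](ACl (6*1*9*4*7*3*5*8*2)).
Qed.

Lemma infinitesimal_multiplicative x y :
  d_gamma_alpha A (defm D 1) x y = d_alpha_alpha A (defa D 1) x y.
Proof.
have /(congr1 (fun u : fps L => u 1%N)) :=
  def_multiplicative D (fps_const x) (fps_const y).
rewrite coef1_defm_t (coef1_defa_t (defm_t D _ _)) !coef0_defm_t !coef0_defa_t.
rewrite !defm_tE !defa_tE.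
rewrite /d_gamma_alpha /d_alpha_alpha => H; apply/eqP.
(* Both subtracted terms change sides, which gives [H] up to commutativity. *)
by rewrite subr_eq addrAC eq_sym subr_eq addrC H addrC.
Qed.

End Coefficients.

Theorem proposition7p3 (K : fieldType) (charK0 : [pchar K] =i pred0)
    (G : finGroupType) (L : lmodType K) (A : homLeibniz L)
    (multA : multiplicative A) (rho : homLeibniz_action G A)
    (D : equivariant_deformation rho) :
  CL2G rho (infinitesimal D) /\ coboundary A (infinitesimal D) = 0.
Proof.
split.
  split; last by split=> [g x y|g x]; [exact: defm_equiv | exact: defa_equiv].
  split=> [x|y|] a u v /=; first exact: linearPr.
    exact: linearPl.
  exact: GRing.linearP.
(* Subtraction of maps is pointwise, so each component vanishes once its two terms agree at all
   arguments. *)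
congr pair; rewrite /=.
  apply/funext => x; apply/funext => y; apply/funext => z.
  by apply/eqP; rewrite GRing.subr_eq0 infinitesimal_hom_leibniz.
apply/funext => x; apply/funext => y.
by apply/eqP; rewrite GRing.subr_eq0 infinitesimal_multiplicative.
Qed.
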